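(* Let $\lambda$ be an integral dominant weight of a simple Lie algebra $\mathfrak{g}$ with Weyl group $W$. Then for any weight $\mu$, the Weyl alternation set $\mathcal{A}(\lambda,\mu)$ is a (possibly empty) order ideal in the left and in the right weak Bruhat orders of $W$.
   Context: $\mathfrak{g}$ is a finite-dimensional simple Lie algebra over $\mathbb{C}$ of rank $r\ge 1$, with simple roots $\alpha_1,\dots,\alpha_r$, positive roots $\Phi^+$, $\rho=\frac12\sum_{\alpha\in\Phi^+}\alpha$, and Weyl group $W$ generated by the simple reflections $s_i(v)=v-2\frac{(\alpha_i,v)}{(\alpha_i,\alpha_i)}\alpha_i$, where $(\cdot,\cdot)$ is a $W$-invariant inner product; $\ell$ is the length function. A weight $\lambda$ is integral if $2(\lambda,\alpha)/(\alpha,\alpha)\in\mathbb{Z}$ for all roots $\alpha$, and dominant if $(\lambda,\alpha)\ge 0$ for all positive roots $\alpha$. Kostant's partition function $\wp(\xi)$ is the number of ways of expressing $\xi$ as a linear combination of the positive roots with nonnegative integer coefficients. For integral weights $\lambda,\mu$ the Weyl alternation set is $\mathcal{A}(\lambda,\mu)=\{\sigma\in W : \wp(\sigma(\lambda+\rho)-\mu-\rho)>0\}$. The right weak (Bruhat) order on $W$ is the reflexive transitive closure of the covering relations $\sigma\lessdot_R\sigma s_i$ whenever $\ell(\sigma s_i)>\ell(\sigma)$; the left weak (Bruhat) order is that of $\sigma\lessdot_L s_i\sigma$ whenever $\ell(s_i\sigma)>\ell(\sigma)$. An order ideal of a poset is a subset $I$ such that $y\in I$ and $x\le y$ imply $x\in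 I$. *)

(* Defs.v *)
From HB Require Import structures.
From Stdlib Require Export Relation_Operators.
From mathcomp Require Export all_boot all_order all_algebra.
From mathcomp Require Export finmap.
From mathcomp Require Export boolp classical_sets cardinality reals.
From mathcomp Require Export complex.

Set Implicit Arguments.
Unset Strict Implicit.
Unset Printing Implicit Defensive.

Import Order.TTheory GRing.Theory Num.Theory.

Local Open Scope classical_set_scope.
Local Open Scope ring_scope.
Local Open Scope complex_scope.

Record lie_bracket (K : fieldType) (g : vectType K) := LieBracket {
  lie_op :> g -> g -> g;
  lie_linearl : forall y, linear (fun x => lie_op x y);
  lie_linearr : forall x, linear (lie_op x);
  lie_alt : forall x, lie_op x x = 0;
  lie_jacobi : forall x y z,
    lie_op x (lie_op y z) + lie_op y (lie_op z x) + lie_op z (lie_op x y) = 0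
}.

Section LieAlgebra.
Variables (K : fieldType) (g : vectType K) (br : lie_bracket g).

Definition lie_ideal (I : {vspace g}) : Prop :=
  forall x y, y \in I -> br x y \in I.

Definition lie_abelian : Prop := forall x y, br x y = 0.

Definition lie_simple : Prop :=
  ~ lie_abelian /\
  forall I : {vspace g}, lie_ideal I -> I = 0%VS \/ I = fullv.

Definition lie_subalgebra (h : {vspace g}) : Prop :=
  forall x y, x \in h -> y \in h -> br x y \in h.

(* The span of all brackets [x, y] with x in U and y in V. *)
Definition bracketv (U V : {vspace g}) : {vspace g} :=
  <<[seq br x y | x <- vbasis U, y <- vbasis V]>>%VS.

Definition lie_nilpotent (h : {vspace g}) : Prop :=
  exists n, iter n (bracketv h) h = 0%VS.

(* Cartan subalgebra: a nilpotent subalgebra equal to its own normalizer. *)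
Definition cartan_subalgebra (h : {vspace g}) : Prop :=
  [/\ lie_subalgebra h, lie_nilpotent h &
      forall x, (forall y, y \in h -> br x y \in h) -> x \in h].

Definition dual (h : {vspace g}) : vectType K := 'Hom(subvs_of h, K^o).

Section Roots.
Variable h : {vspace g}.

Definition root_space (a : dual h) : set g :=
  [set x | forall t : subvs_of h, br (vsval t) x = a t *: x].

Definition roots : set (dual h) :=
  [set a | a != 0 /\ exists2 x, root_space a x & x != 0].

(* t is the coroot of a: it is the neutral element of an sl_2-triple
   (e, t, f) with e and f in the root spaces of a and -a. *)
Definition is_coroot (a : dual h) (t : subvs_of h) : Prop :=
  a t = 2%:R /\
  exists e f, [/\ root_space a e, root_space (- a) f & br e f = vsval t].

Section Base.
Variables (r : nat) (Delta : r.-tuple (dual h)).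

Definition nonneg_comb (b : dual h) : Prop :=
  exists n : 'I_r -> nat, b = \sum_(i < r) tnth Delta i *+ n i.

(* Delta is a system of simple roots. *)
Definition simple_roots : Prop :=
  [/\ basis_of fullv Delta,
      forall i, roots (tnth Delta i) &
      forall b, roots b -> nonneg_comb b \/ nonneg_comb (- b)].

(* fset_set turns a finite set into a finmap set; there are finitely many
   roots, so its default value on infinite sets plays no role here. *)
Definition pos_roots : {fset dual h} :=
  fset_set [set b | roots b /\ nonneg_comb b].

Definition rho : dual h := 2%:R^-1 *: \sum_(b <- pos_roots) b.

(* The number of families (n_b), indexed by the positive roots b, of
   nonnegative integers with \sum_b n_b b = xi; each xi has finitely many. *)
Definition kostant (xi : dual h) : nat :=
  #|` fset_set [set n : {ffun pos_roots -> nat} |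
        \sum_(b : pos_roots) val b *+ n b = xi] |.

End Base.
End Roots.
End LieAlgebra.

(* The Weyl group acts on h^* = E (x)_R C, where E is the real span of the
   roots. An inner product on E is represented by its C-bilinear extension B
   to h^*: a symmetric bilinear form, positive definite on E. The order of
   R[i] is such that 0 < z forces z to be real, so that B is real on E x E by
   polarization. *)
Section WeylGroup.
Variables (R : realType) (g : vectType R[i]) (br : lie_bracket g).
Variables (h : {vspace g}) (r : nat) (Delta : r.-tuple (dual h)).
Variable B : dual h -> dual h -> R[i].

Definition inner_product : Prop :=
  [/\ forall v, linear (fun u => B u v : R[i]^o),
      forall u v, B u v = B v u &
      forall c : 'I_r -> R,
        let v := \sum_(i < r) (c i)%:C *: tnth Delta i in
        v != 0 -> 0 < B v v].

(* Invariance under the Weyl group, which is generated by the maps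
   v |-> v - v(t) a with a a simple root and t its coroot. These are described
   here independently of B: every form is invariant under the reflections it
   defines itself. *)
Definition weyl_invariant : Prop :=
  forall i, exists2 t, is_coroot br (tnth Delta i) t &
    let s (v : dual h) := v - v t *: tnth Delta i in
    forall u v, B (s u) (s v) = B u v.

Definition simple_refl (i : 'I_r) (v : dual h) : dual h :=
  let a := tnth Delta i in v - (2%:R * B a v / B a a) *: a.

(* s_(i_1) \o ... \o s_(i_k) for the word i_1 ... i_k. *)
Definition word_refl (s : seq 'I_r) : dual h -> dual h :=
  foldr (fun i f => simple_refl i \o f) id s.

(* The simple reflections being involutions, the group that they generate
   consists of the products of words in them. *)
Definition weyl_group : set (dual h -> dual h) := range word_refl.

Definition has_word (w : dual h -> dual h) (n : nat) : bool :=
  `[< exists2 s, size s = n & word_refl s = w >].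

Definition weyl_length (w : dual h -> dual h) : nat :=
  if pselect (exists n, has_word w n) is left ex then ex_minn ex else 0%N.

Definition right_cover (x y : dual h -> dual h) : Prop :=
  weyl_group x /\ exists2 i, y = x \o simple_refl i &
    (weyl_length x < weyl_length y)%N.

Definition left_cover (x y : dual h -> dual h) : Prop :=
  weyl_group x /\ exists2 i, y = simple_refl i \o x &
    (weyl_length x < weyl_length y)%N.

Definition right_weak_order := clos_refl_trans _ right_cover.

Definition left_weak_order := clos_refl_trans _ left_cover.

Definition integral (l : dual h) : Prop :=
  forall a, roots br a -> exists m : int, 2%:R * B l a / B a a = m%:~R.

Definition dominant (l : dual h) : Prop :=
  forall a, a \in pos_roots br Delta -> 0 <= B l a.

Definition alternation_set (l m : dual h) : set (dual h -> dual h) :=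
  let rho := rho br Delta in
  [set w | weyl_group w /\ (0 < kostant br Delta (w (l + rho) - m - rho)%R)%N].

End WeylGroup.

(* I is an order ideal of the poset (P, le). *)
Definition order_ideal (T : Type) (P : set T) (le : T -> T -> Prop)
    (I : set T) : Prop :=
  I `<=` P /\ forall x y, P x -> P y -> le x y -> I y -> I x.

(* Main.v *)
Require Import Defs.
From mathcomp Require Import ring.
Import Order.TTheory GRing.Theory Num.Theory.

(** Write nu = lambda + rho and let y cover x in one of the two weak orders.
Then x and y differ by a reflection, and
    x nu = y nu + c beta
for a positive root beta and a natural number c: in the right order
y = x s_i and beta = x alpha_i, in the left order y = s_i x and
beta = alpha_i. Hence a decomposition of y nu - mu - rho into positive roots
becomes one of x nu - mu - rho after c more copies of beta are added, and
membership in the alternation set passes from y down to x.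

Two facts make this work. First, the length goes up along the cover, and this
forces x alpha_i, respectively x^-1 alpha_i, to be a positive root: if the
image of alpha_i under a word is not positive, then the exchange argument of
[word_refl_shorten] deletes a letter, so that the length goes down. Second, c
is a natural number. It is the pairing of nu with the coroot of alpha_i,
respectively of x^-1 alpha_i; it is an integer because roots pair integrally
with simple coroots, and it is nonnegative because nu is dominant.

The properties of roots used here come from the representation theory of sl_2:
there are finitely many roots because weight vectors of distinct weights are
independent ([finite_weights]), and the strings of [root_string] show that
simple reflections permute the roots ([weight_refl]) and that roots pair
integrally with coroots ([weight_coroot_int]). That rho pairs naturally with
every simple coroot ([rho_dominant_integral]) follows as usual from the way
in which a simple reflection permutes the positive roots.

Kostant's function is the cardinal of a set of families, so its positivity
amounts to the existence of one family only once the set is known to be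
finite; the height bounds the multiplicities ([finite_partitions]). *)

Local Open Scope classical_set_scope.
Local Open Scope ring_scope.
Local Open Scope complex_scope.

Set Implicit Arguments.
Unset Strict Implicit.
Unset Printing Implicit Defensive.

(** * Weights of the adjoint action *)

Section Weights.
Variables (K : fieldType) (g : vectType K) (br : lie_bracket g).

Lemma lieDr x y z : br x (y + z) = br x y + br x z.
Proof. by have := lie_linearr br x 1 y z; rewrite !scale1r. Qed.

Lemma lie0r x : br x 0 = 0.
Proof. by apply: (addrI (br x 0)); rewrite -lieDr !addr0. Qed.

Lemma lieZr x k y : br x (k *: y) = k *: br x y.
Proof. by have := lie_linearr br x k y 0; rewrite lie0r !addr0. Qed.

Lemma lieDl x y z : br (x + y) z = br x z + br y z.
Proof. by have := lie_linearl br z 1 x y; rewrite !scale1r. Qed.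

Lemma lieC x y : br x y = - br y x.
Proof.
apply/eqP; rewrite -addr_eq0; apply/eqP.
by have := lie_alt br (x + y); rewrite lieDr !lieDl !lie_alt addr0 add0r addrC.
Qed.

Lemma lieNr x y : br x (- y) = - br x y.
Proof. by rewrite -scaleN1r lieZr scaleN1r. Qed.

Lemma lieZl k x y : br (k *: x) y = k *: br x y.
Proof. by rewrite lieC lieZr -scalerN -lieC. Qed.

Lemma lie_sumr (I : Type) (s : seq I) x (F : I -> g) :
  br x (\sum_(i <- s) F i) = \sum_(i <- s) br x (F i).
Proof.
elim: s => [|i s IH]; first by rewrite !big_nil lie0r.
by rewrite !big_cons lieDr IH.
Qed.

Lemma lie_leibniz x y z : br x (br y z) = br (br x y) z + br y (br x z).
Proof.
have := lie_jacobi br x y z; rewrite (lieC z (br x y)) (lieC z x) lieNr.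
by move/eqP; rewrite subr_eq0 subr_eq => /eqP.
Qed.

Variable h : {vspace g}.
Implicit Types (a b : dual h) (t : subvs_of h).

Definition weight b := exists2 x, root_space br b x & x != 0.

Lemma root_space0 b : root_space br b 0.
Proof. by move=> t; rewrite lie0r scaler0. Qed.

Lemma root_spaceZ b k x : root_space br b x -> root_space br b (k *: x).
Proof. by move=> bx t; rewrite lieZr bx !scalerA mulrC. Qed.

Lemma root_space_lie a b x y :
  root_space br a x -> root_space br b y -> root_space br (a + b) (br x y).
Proof.
by move=> ax bz t; rewrite lie_leibniz ax bz lieZr lieZl lfunE scalerDl.
Qed.

(** Applying ad t - b t to a vanishing sum kills its component of weight b and
rescales every other component c by (c - b) t, which is nonzero for a suitable
t; this removes one weight at a time. *)
Lemma root_space_indep (s : seq (dual h)) (y : dual h -> g) :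
    uniq s -> (forall b, root_space br b (y b)) ->
  \sum_(b <- s) y b = 0 -> forall b, b \in s -> y b = 0.
Proof.
elim: s y => // b s IH y /= /andP[bs us] yP; rewrite big_cons => sum0.
have y0 c : c \in s -> y c = 0.
  move=> cs.
  have [t tP] : exists t, c t - b t != 0.
    apply: contrapT => /forallNP P; move: bs; suff -> : b = c by rewrite cs.
    apply/lfunP => t; apply/esym/eqP; rewrite -subr_eq0.
    by apply/negbNE/negP => Q; apply: (P t).
  have := IH (fun c => (c t - b t) *: y c) us (fun c => root_spaceZ _ (yP c)).
  move=> /(_ _ _ cs) /=.
  suff -> : \sum_(c0 <- s) (c0 t - b t) *: y c0 = 0.
    by move=> /(_ erefl) /eqP; rewrite scaler_eq0 (negPf tP) => /eqP.
  have : br (vsval t) (y b + \sum_(j <- s) y j) - b t *: (y b + \sum_(j <- s) y j) = 0.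
    by rewrite sum0 lie0r scaler0 subr0.
  rewrite lieDr lie_sumr yP scalerDr opprD addrACA subrr add0r scaler_sumr.
  rewrite -sumrB => sumB; rewrite -[RHS]sumB.
  by apply: eq_bigr => j _; rewrite scalerBl yP.
move=> c; rewrite inE => /orP[/eqP ->|/y0 //].
by move: sum0; rewrite big1_seq ?addr0 // => j /andP[_ /y0].
Qed.

(** Independence bounds the number of weights by the dimension of g. *)
Lemma finite_weights : finite_set weight.
Proof.
apply: contrapT => /(infinite_set_fset (\dim {:g}).+1) [A AP]; rewrite ltnNge.
have /choice [x xP] : forall b, exists x, root_space br b x /\ (b \in A -> x != 0).
  move=> b; case: (boolP (b \in A)) => bA; last by exists 0; split=> //; exact: root_space0.
  by have [x] := AP b bA; exists x.
pose X := in_tuple (A : seq (dual h)).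
have injX : injective (tnth X) by apply/tuple_uniqP; exact: fset_uniq.
have frX : free (map_tuple x X).
  apply/freeP => k sum0 i.
  (* The sum has exactly one term when b is in A; this indexes the coefficients
     by the weights themselves. *)
  pose y b := \sum_(j | tnth X j == b) k j *: x b.
  have yX j : y (tnth X j) = k j *: x (tnth X j).
    by rewrite /y (big_pred1 j) // => l /=; rewrite (inj_eq injX).
  have yP b : root_space br b (y b).
    by rewrite /y -scaler_suml; apply: root_spaceZ; have [] := xP b.
  have sumy : \sum_(b <- A) y b = 0.
    rewrite (big_tnth _ _ (A : seq (dual h))) -[RHS]sum0.
    apply: eq_bigr => j _; rewrite -/X yX.
    by rewrite (nth_map (tnth X j)) // -tnth_nth.
  have Xi : tnth X i \in A := mem_tnth i X.
  have /eqP := root_space_indep (fset_uniq A) yP sumy Xi.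
  by rewrite yX scaler_eq0 (negPf ((xP _).2 Xi)) orbF => /eqP.
by have := dimvS (subvf <<map x A>>%VS); rewrite (eqP frX) size_map => ->.
Qed.
End Weights.

(** * Root strings *)

Section Sl2.
Variables (K : numFieldType) (g : vectType K) (br : lie_bracket g).
Variable h : {vspace g}.
Implicit Types (a b : dual h) (t : subvs_of h).

Lemma root_space_iter a b e x k :
    root_space br a e -> root_space br b x ->
  root_space br (b + a *+ k) (iter k (br e) x).
Proof.
move=> ae bx; elim: k => [|k IH]; first by rewrite addr0.
by rewrite mulrS addrCA; apply: root_space_lie.
Qed.

Lemma dual_mulrn a k t : (a *+ k) t = k%:R * a t.
Proof. by rewrite -scaler_nat scale_lfunE. Qed.

(** The vectors (ad e)^k x have the distinct weights b + k a, of which only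
finitely many can occur. *)
Lemma ad_nilpotent a b e x : a != 0 ->
    root_space br a e -> root_space br b x -> x != 0 ->
  exists2 k, iter k (br e) x != 0 & iter k.+1 (br e) x = 0.
Proof.
move=> a0 ae bx x0; apply: contrapT => /forall2NP nil.
have nz k : iter k (br e) x != 0.
  by elim: k => // k IH; have [] := nil k; [rewrite IH | move/eqP].
have inj : injective (fun k => b + a *+ k).
  move=> k l /addrI /eqP; rewrite -!scaler_nat -subr_eq0 -scalerBl scaler_eq0.
  by rewrite (negPf a0) orbF subr_eq0 eqr_nat => /eqP.
apply: infinite_nat.
rewrite -(eq_finite_set (inj_card_eq (A := [set: nat]) (in2W inj))).
apply: sub_finite_set (finite_weights br h) => _ [k _ <-].
by exists (iter k (br e) x) => //; apply: root_space_iter.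
Qed.

Lemma coroot_opp a t : is_coroot br a t -> is_coroot br (- a) (- t).
Proof.
case=> at2 [e [f [ae af ef]]]; split; first by rewrite opp_lfunE linearN opprK.
by exists f, e; rewrite opprK lieC ef linearN.
Qed.

(** The commutation rule of sl_2 for a highest weight vector y of weight c. *)
Lemma ad_lower_raise a c e f t y j :
    a t = 2%:R -> root_space br a e -> root_space br (- a) f ->
    br e f = vsval t -> root_space br c y -> br e y = 0 ->
  br e (iter j.+1 (br f) y) =
  (j.+1%:R * (c t - j%:R)) *: iter j (br f) y.
Proof.
move=> at2 ae af ef cy ey; elim: j => [|j IH].
  by rewrite /= lie_leibniz ef cy ey lie0r addr0 mul1r subr0.
have /= := root_space_iter j.+1 af cy => /(_ t).
rewrite add_lfunE dual_mulrn opp_lfunE at2 => tP.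
rewrite lie_leibniz ef tP [br e _]IH lieZr -scalerDl.
by congr (_ *: _); rewrite -!natr1; ring.
Qed.

(** From a vector of weight b, raise until the highest vector y of the string,
of weight b + k a, then lower until f^(l+1) y = 0. By [ad_lower_raise] the last
lowering step is possible only when y has t-eigenvalue l, so l is the number c
and all of y, f y, ..., f^c y are nonzero. *)
Lemma root_string a b t : is_coroot br a t -> weight br b ->
  exists c k : nat, b t + 2%:R * k%:R = c%:R :> K /\
    (forall j, (j <= c)%N -> weight br (b + a *+ k - a *+ j)).
Proof.
move=> [at2 [e [f [ae af ef]]]] [x bx x0].
have a0 : a != 0.
  apply: contra_eq_neq at2 => ->; rewrite lfunE /= eq_sym; by rewrite pnatr_eq0.
have [k yn0 y0] := ad_nilpotent a0 ae bx x0.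
have cy := root_space_iter k ae bx.
set y := iter k _ x in yn0 cy; set c := b + _ in cy.
have na0 : - a != 0 by rewrite oppr_eq0.
have [l zn0 z0] := ad_nilpotent na0 af cy yn0.
exists l, k; split.
  have := ad_lower_raise l at2 ae af ef cy y0.
  rewrite z0 lie0r => /esym/eqP; rewrite scaler_eq0 (negPf zn0) orbF.
  rewrite mulf_eq0 pnatr_eq0 /= subr_eq0 => /eqP <-.
  by rewrite add_lfunE dual_mulrn at2 mulrC.
move=> j jl; exists (iter j (br f) y).
  by rewrite -mulNrn; apply: root_space_iter.
apply: contra zn0 => /eqP yj0.
by rewrite -(subnK jl) iterD yj0; elim: (l - j)%N => //= n /eqP ->; rewrite lie0r.
Qed.

Lemma weight_coroot_int a b t : is_coroot br a t -> weight br b ->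
  exists m : int, b t = m%:~R :> K.
Proof.
move=> at2 /(root_string at2) [c [k [ck _]]]; exists (c%:Z - 2%:Z * k%:Z).
by rewrite rmorphB rmorphM /= -!pmulrn -ck addrK.
Qed.

(** When b t = c - 2k is nonnegative, the reflected weight lies at step c - k of
the string of [root_string]. When it is negative, that step need not be in
range, but then the string of the opposite triple (f, - t, e) reaches it. *)
Lemma weight_refl a b t : is_coroot br a t -> weight br b ->
  weight br (b - b t *: a).
Proof.
move=> ta wb; have [c [k [ck wj]]] := root_string ta wb.
have [c' [k' [ck' wj']]] := root_string (coroot_opp ta) wb.
rewrite [b (- t)]linearN /= in ck'.
have [kc|ck2] := leqP k.*2 c.
  have -> : b - b t *: a = b + a *+ k - a *+ (c - k).
    have kc' : (k <= c)%N by apply: leq_trans kc; rewrite -addnn leq_addr.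
    rewrite -!scaler_nat -addrA -scalerBl -scaleNr natrB // -ck.
    by congr (_ + _ *: _); ring.
  by apply: wj; rewrite leq_subr.
have kc' : (k'.*2 <= c')%N.
  rewrite -(ler_nat K) -ck' -muln2 natrM mulrC lerDr oppr_ge0.
  rewrite -(lerD2r (2%:R * k%:R)) add0r ck -natrM ler_nat mul2n; exact: ltnW.
have -> : b - b t *: a = b + (- a) *+ k' - (- a) *+ (c' - k').
  have kc2 : (k' <= c')%N by apply: leq_trans kc'; rewrite -addnn leq_addr.
  rewrite -!scaler_nat -addrA -scalerBl natrB // -ck' -scalerN.
  by congr (_ + _ *: _); ring.
by apply: wj'; rewrite leq_subr.
Qed.
End Sl2.

(** * Simple reflections and roots *)

Section Reflections.
Variables (R : realType) (g : vectType R[i]) (br : lie_bracket g).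
Variables (h : {vspace g}) (r : nat) (Delta : r.-tuple (dual h)).
Variable B : dual h -> dual h -> R[i].
Hypothesis Delta_simple : simple_roots br Delta.
Hypothesis B_inner : inner_product Delta B.
Hypothesis B_inv : weyl_invariant br Delta B.

Local Notation al := (tnth Delta).
Local Notation s_ := (simple_refl Delta B).
Local Notation word := (word_refl Delta B).
Implicit Types (u v b : dual h) (i j : 'I_r) (s : seq 'I_r).

Definition positive_root b := roots br b /\ nonneg_comb Delta b.

(** The value at v of the coroot of the i-th simple root, expressed by B. *)
Definition pairing i v : R[i] := 2%:R * B (al i) v / B (al i) (al i).

Lemma formC u v : B u v = B v u. Proof. by case: B_inner. Qed.

Lemma formDl u v w : B (u + v) w = B u w + B v w.
Proof. by case: B_inner => /(_ w 1 u v); rewrite scale1r => ->; rewrite scale1r. Qed.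

Lemma form0l w : B 0 w = 0.
Proof. by apply: (addrI (B 0 w)); rewrite -formDl !addr0. Qed.

Lemma formZl k u w : B (k *: u) w = k * B u w.
Proof. by case: B_inner => /(_ w k u 0); rewrite form0l !addr0. Qed.

Lemma formDr u v w : B w (u + v) = B w u + B w v.
Proof. by rewrite formC formDl !(formC w). Qed.

Lemma formZr k u w : B w (k *: u) = k * B w u.
Proof. by rewrite formC formZl formC. Qed.

Lemma form_suml I (t : seq I) (F : I -> dual h) w :
  B (\sum_(i <- t) F i) w = \sum_(i <- t) B (F i) w.
Proof.
elim: t => [|x t IH]; first by rewrite !big_nil form0l.
by rewrite !big_cons formDl IH.
Qed.

Lemma simple_root i : roots br (al i).
Proof. by case: Delta_simple. Qed.

Lemma simple_neq0 i : al i != 0.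
Proof. by case: (simple_root i). Qed.

Lemma simple_positive i : positive_root (al i).
Proof.
split; first exact: simple_root.
exists (fun j => j == i); rewrite (bigD1 i) //= eqxx mulr1n big1 ?addr0 // => j.
by move/negPf->.
Qed.

Lemma form_simple_gt0 i : 0 < B (al i) (al i).
Proof.
case: B_inner => _ _ /(_ (fun j => (j == i)%:R)) /=.
suff -> : \sum_j ((j == i)%:R : R)%:C *: al j = al i.
  by apply; exact: simple_neq0.
rewrite (bigD1 i) //= eqxx scale1r big1 ?addr0 // => j /negPf ->.
by rewrite scale0r.
Qed.

Lemma form_simple_neq0 i : B (al i) (al i) != 0.
Proof. by rewrite gt_eqF ?form_simple_gt0. Qed.

Lemma pairingD i u v : pairing i (u + v) = pairing i u + pairing i v.
Proof. by rewrite /pairing formDr mulrDr mulrDl. Qed.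

Lemma pairingZ i k v : pairing i (k *: v) = k * pairing i v.
Proof. by rewrite /pairing formZr mulrCA !mulrA. Qed.

Lemma pairing_simple i : pairing i (al i) = 2%:R.
Proof. by rewrite /pairing mulfK ?form_simple_neq0. Qed.

Lemma simple_reflE i v : s_ i v = v - pairing i v *: al i. Proof. by []. Qed.

(** Invariance of B under v |-> v - v t alpha_i forces the values of the coroot
t to be those given by B, so that the reflections defined by B are the ones to
which the sl_2-theory applies. *)
Lemma coroot_simple i :
  exists2 t, is_coroot br (al i) t & forall v, pairing i v = v t.
Proof.
have [t tP inv] := B_inv i; exists t => // v.
have := inv v (al i); rewrite (tP.1) scalerDl scale1r opprD addNKr.
rewrite -[- al i]scaleN1r formZr formDl -scaleNr formZl => H.
apply: (mulIf (form_simple_neq0 i)); rewrite /pairing divfK ?form_simple_neq0 //.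
rewrite (formC _ v).
have -> : v t * B (al i) (al i) = B v (al i) - (B v (al i) + - v t * B (al i) (al i)).
  by ring.
by rewrite -[X in _ - X]mul1r -mulNr H; ring.
Qed.

Lemma simple_reflK i : involutive (s_ i).
Proof.
move=> v; have pairN : pairing i (s_ i v) = - pairing i v.
  by rewrite simple_reflE -scaleNr pairingD pairingZ pairing_simple; ring.
by rewrite simple_reflE pairN scaleNr opprK simple_reflE subrK.
Qed.

Lemma form_simple_refl i u v : B (s_ i u) (s_ i v) = B u v.
Proof.
have sE w : s_ i w = w + (- pairing i w) *: al i by rewrite scaleNr.
rewrite !sE !(formDl, formDr, formZl, formZr) /pairing (formC u (al i)).
by field; exact: form_simple_neq0.
Qed.

Lemma simple_reflD i u v : s_ i (u + v) = s_ i u + s_ i v.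
Proof. by rewrite !simple_reflE pairingD scalerDl opprD addrACA. Qed.

Lemma simple_reflZ i k v : s_ i (k *: v) = k *: s_ i v.
Proof. by rewrite !simple_reflE pairingZ scalerBr scalerA. Qed.

Lemma simple_refl_sum i (t : seq (dual h)) :
  s_ i (\sum_(b <- t) b) = \sum_(b <- t) s_ i b.
Proof.
elim: t => [|x t IH]; last by rewrite !big_cons simple_reflD IH.
by rewrite !big_nil; have := simple_reflZ i 0 0; rewrite !scale0r.
Qed.

Lemma word_reflB s u v : word s (u - v) = word s u - word s v.
Proof.
elim: s => [//|i s IH]; rewrite /= IH.
by rewrite simple_reflD -scaleN1r simple_reflZ scaleN1r.
Qed.

Lemma word_reflZ s k v : word s (k *: v) = k *: word s v.
Proof. by elim: s => //= i s ->; rewrite simple_reflZ. Qed.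

Lemma form_word_refl s u v : B (word s u) (word s v) = B u v.
Proof. by elim: s => //= i s IH; rewrite form_simple_refl. Qed.

Lemma word_refl_rcons s i v : word (rcons s i) v = word s (s_ i v).
Proof. by elim: s => [//|j s IH]; rewrite rcons_cons /= IH. Qed.

Lemma word_refl_revK s : cancel (word (rev s)) (word s).
Proof.
elim: s => [//|i s IH] v.
by rewrite rev_cons word_refl_rcons [LHS]/= IH simple_reflK.
Qed.

Lemma word_reflK s : cancel (word s) (word (rev s)).
Proof. by move=> v; have := word_refl_revK (rev s) v; rewrite revK. Qed.

Lemma root_simple_refl i b : roots br b -> roots br (s_ i b).
Proof.
case=> b0 wb; split.
  apply: contraNneq b0 => sb0; rewrite -(simple_reflK i b) sb0.
  by have := simple_reflZ i 0 0; rewrite !scale0r => ->.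
have [t tP pairE] := coroot_simple i.
by rewrite simple_reflE pairE; apply: (weight_refl tP).
Qed.

Lemma root_word_refl s b : roots br b -> roots br (word s b).
Proof. by move=> rb; elim: s => //= i s; apply: root_simple_refl. Qed.

Lemma pairing_root_int i b : roots br b -> exists m : int, pairing i b = m%:~R.
Proof.
case=> _ wb; have [t tP pairE] := coroot_simple i.
by rewrite pairE; apply: (weight_coroot_int tP).
Qed.

Lemma coord_nonneg_comb b (n : 'I_r -> nat) i :
  b = \sum_(i < r) al i *+ n i -> coord Delta i b = (n i)%:R.
Proof.
case: Delta_simple => /basis_free frD _ _ ->.
rewrite -(coord_sum_free (fun i => (n i)%:R) i frD); congr (coord _ _ _).
by apply: eq_bigr => j _; rewrite scaler_nat (tnth_nth 0).
Qed.

(** Reflecting in alpha_i changes only the i-th coordinate of b. If the result is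
negative, then all the other coordinates vanish. *)
Lemma positive_root_simple_refl i b : positive_root b ->
  positive_root (s_ i b) \/ exists2 n, (0 < n)%N & b = al i *+ n.
Proof.
move=> [rb [n bn]]; have rsb := root_simple_refl i rb.
case: (Delta_simple) => _ _ /(_ _ rsb) [|[m sbm]]; first by left.
right; have nj j : j != i -> n j = 0%N.
  move=> ji; have := coord_nonneg_comb j sbm.
  rewrite simple_reflE opprB linearB linearZ /= (coord_nonneg_comb j bn).
  case: (Delta_simple) => /basis_free frD _ _.
  rewrite (tnth_nth 0) (coord_free i j frD) eq_sym (negPf ji) mulr0 sub0r.
  by move/eqP; rewrite eqr_oppLR -subr_eq0 opprK -natrD pnatr_eq0 addn_eq0 => /andP[/eqP].
have bi : b = al i *+ n i.
  by rewrite bn (bigD1 i) //= big1 ?addr0 // => j /nj ->.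
exists (n i) => //; rewrite lt0n; case: rb => + _.
by apply: contra => /eqP n0; rewrite bi n0.
Qed.

(** This is w s_a w^-1 = s_(w a), for a vector w a on the line of a simple
root. *)
Lemma word_refl_conj s i j k : k != 0 -> word s (al i) = k *: al j ->
  word s \o s_ i = s_ j \o word s.
Proof.
move=> k0 wal; apply/funext => v /=.
have pairE : pairing j (word s v) = pairing i v * k.
  rewrite /pairing -(form_word_refl s (al i) v) -(form_word_refl s (al i) (al i)) wal.
  rewrite !(formZl, formZr); field; by rewrite form_simple_neq0 k0.
by rewrite !simple_reflE word_reflB word_reflZ wal pairE scalerA.
Qed.

(** Exchange argument: as the letters of the word act one after the other,
alpha_i leaves the positive roots at some letter j. Just before, its image is a
positive multiple of alpha_j, hence s_i on the right cancels that letter. *)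
Lemma word_refl_shorten s i : ~ positive_root (word s (al i)) ->
  exists2 s', (size s' < size s)%N & word s' = word s \o s_ i.
Proof.
elim: s => [|j s IH]; first by case; exact: simple_positive.
have [pos|/IH [s' ss' ws']] := pselect (positive_root (word s (al i))); last first.
  exists (j :: s'); first by rewrite /= ltnS.
  by rewrite [LHS]/= ws'.
case: (positive_root_simple_refl j pos) => [+ /(_ _)//|[n n0 wal] _].
exists s; first exact: ltnSn.
have n0' : n%:R != 0 :> R[i] by rewrite pnatr_eq0 -lt0n.
rewrite -scaler_nat in wal; apply/funext => v.
have /(congr1 (@^~ v)) wsi := word_refl_conj n0' wal.
by rewrite [RHS]/= -[word s (s_ i v)]/((word s \o s_ i) v) wsi [RHS]simple_reflK.
Qed.

Lemma size_weyl_length s : (weyl_length Delta B (word s) <= size s)%N.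
Proof.
rewrite /weyl_length; case: pselect => // ex; case: ex_minnP => m _; apply.
by apply/asboolP; exists s.
Qed.

Lemma reduced_word w : weyl_group Delta B w ->
  exists2 s, size s = weyl_length Delta B w & word s = w.
Proof.
move=> [s _ sw]; rewrite /weyl_length; case: pselect => [ex|[]].
  by case: ex_minnP => m /asboolP.
by exists (size s); apply/asboolP; exists s.
Qed.

Lemma right_ascent_positive s i :
    (size s = weyl_length Delta B (word s))%N ->
    (weyl_length Delta B (word s) < weyl_length Delta B (word s \o s_ i))%N ->
  positive_root (word s (al i)).
Proof.
move=> sl lt; apply: contrapT => /word_refl_shorten [s' ss' ws'].
move: lt; rewrite -ws' -sl ltnNge => /negP; apply.
exact: leq_trans (size_weyl_length s') (ltnW ss').
Qed.

(** The left order is the right order of the inverses, and the reversed word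
represents the inverse. *)
Lemma left_ascent_positive s i :
    (size s = weyl_length Delta B (word s))%N ->
    (weyl_length Delta B (word s) < weyl_length Delta B (s_ i \o word s))%N ->
  positive_root (word (rev s) (al i)).
Proof.
move=> sl lt; apply: contrapT => /word_refl_shorten [s' ss' ws'].
have ws : word (rev s') = s_ i \o word s.
  apply/funext => v /=; apply: (can_inj (word_reflK s')).
  by rewrite word_refl_revK ws' /= simple_reflK word_reflK.
move: lt; rewrite -ws -sl ltnNge => /negP; apply.
by apply: leq_trans (size_weyl_length _) _; rewrite size_rev -(size_rev s) ltnW.
Qed.

(** * Dominant integral weights and rho *)

Lemma finite_positive_roots : finite_set [set b | roots br b /\ nonneg_comb Delta b].
Proof. by apply: sub_finite_set (finite_weights br h) => b [[_ wb] _]. Qed.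

Lemma in_pos_roots b : (b \in pos_roots br Delta) <-> positive_root b.
Proof. by rewrite /pos_roots in_fset_set ?inE //; exact: finite_positive_roots. Qed.

(** Integrality and dominance are combined and tested on the simple coroots
only, which makes the condition additive and easy to check for rho. *)
Definition dominant_integral v := forall i, exists n : nat, pairing i v = n%:R.

(** Split the positive roots by whether they lie on the line of alpha_i. Those
off the line are permuted by s_i, so their sum is fixed by s_i and pairs to
zero; those on the line add up to N alpha_i with N natural. Half of the total
then pairs to N. *)
Lemma rho_dominant_integral : dominant_integral (rho br Delta).
Proof.
move=> i; set P := pos_roots br Delta.
pose mult b := `[< exists k, b = k *: al i >].
have refl_nonmult b : b \in P -> ~~ mult b -> s_ i b \in P /\ ~~ mult (s_ i b).
  move=> /in_pos_roots pb mb; split.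
    apply/in_pos_roots; case: (positive_root_simple_refl i pb) => // -[n _ bn].
    by case/asboolP: mb; exists n%:R; rewrite scaler_nat.
  apply: contra mb => /asboolP [k sbk]; apply/asboolP; exists (- k).
  rewrite -(simple_reflK i b) sbk simple_reflZ simple_reflE pairing_simple.
  by rewrite -[X in X - _]scale1r -scalerBl scalerA; congr (_ *: _); ring.
have S2 : pairing i (\sum_(b <- P | ~~ mult b) b) = 0.
  set F := [seq b <- P | ~~ mult b].
  have sF : {in F, forall b, s_ i b \in F}.
    move=> b; rewrite !mem_filter => /andP[mb bP].
    by have [-> ->] := refl_nonmult b bP mb.
  have uF : uniq F by rewrite filter_uniq ?fset_uniq.
  have pF : perm_eq (map (s_ i) F) F.
    apply: uniq_perm; [|exact: uF|].
      by rewrite (map_inj_uniq (can_inj (simple_reflK i))).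
    move=> b; apply/mapP/idP => [[c cF ->]|bF]; first exact: sF.
    by exists (s_ i b); [exact: sF|rewrite simple_reflK].
  rewrite -big_filter -/F.
  have : s_ i (\sum_(b <- F) b) = \sum_(b <- F) b.
    by rewrite simple_refl_sum -[RHS](perm_big _ pF) big_map.
  move/eqP; rewrite simple_reflE -subr_eq0 addrAC subrr add0r oppr_eq0 scaler_eq0.
  by rewrite (negPf (simple_neq0 i)) orbF => /eqP.
have [N S1] : exists N, \sum_(b <- P | mult b) b = N%:R *: al i.
  rewrite big_seq_cond.
  elim/big_ind: _ => [|u v [n ->] [m ->]|b /andP[/in_pos_roots [_ [n bn]]]].
  - by exists 0%N; rewrite scale0r.
  - by exists (n + m)%N; rewrite natrD scalerDl.
  case/asboolP => k bk; exists (n i); rewrite -(coord_nonneg_comb i bn).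
  rewrite bk linearZ /=; case: (Delta_simple) => /basis_free frD _ _.
  by rewrite (tnth_nth 0) (coord_free i i frD) eqxx mulr1.
exists N; rewrite /rho -/P (bigID mult) /= pairingZ pairingD S2 addr0 S1 pairingZ pairing_simple.
by field.
Qed.

Lemma dominant_integralD u v :
  dominant_integral u -> dominant_integral v -> dominant_integral (u + v).
Proof.
move=> Du Dv i; have [[n un] [m vm]] := (Du i, Dv i).
by exists (n + m)%N; rewrite pairingD un vm natrD.
Qed.

Lemma integral_dominant_integral v :
  integral br B v -> dominant br Delta B v -> dominant_integral v.
Proof.
move=> vint vdom i; have [m] := vint _ (simple_root i).
rewrite formC -/(pairing i v) => vm.
have : 0 <= pairing i v.
  rewrite divr_ge0 ?(ltW (form_simple_gt0 i)) // mulr_ge0 // formC.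
  by apply: vdom; apply/in_pos_roots; exact: simple_positive.
by rewrite vm ler0z; case: m vm => // n vm _; exists n.
Qed.

(** Reflections subtract integer multiples of simple roots, whose pairings are
integers. *)
Lemma pairing_word_int v s i : dominant_integral v ->
  exists m : int, pairing i (word s v) = m%:~R.
Proof.
move=> Dv; elim: s i => [|j s IH] i /=; first by have [n ->] := Dv i; exists n.
have [[m1 e1] [m2 e2]] := (IH i, IH j).
have [m3 e3] := pairing_root_int i (simple_root j).
exists (m1 - m2 * m3); rewrite simple_reflE -scaleNr pairingD pairingZ e1 e2 e3.
by rewrite rmorphB rmorphM mulNr.
Qed.

Lemma form_positive_root_ge0 v b : dominant_integral v -> positive_root b -> 0 <= B b v.
Proof.
move=> Dv [_ [n ->]]; rewrite form_suml sumr_ge0 // => i _.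
rewrite -scaler_nat formZl mulr_ge0 //.
have [m vm] := Dv i.
suff -> : B (al i) v = 2%:R^-1 * (pairing i v * B (al i) (al i)).
  by rewrite vm !mulr_ge0 ?invr_ge0 // ltW ?form_simple_gt0.
by rewrite /pairing; field; rewrite form_simple_neq0.
Qed.

(** * Positivity of the partition function *)

Definition height b : R[i] := \sum_i coord Delta i b.

Lemma height_positive_root b : positive_root b -> exists2 n, height b = n%:R & (0 < n)%N.
Proof.
move=> [[b0 _] [n bn]]; exists (\sum_i n i)%N.
  by rewrite natr_sum; apply: eq_bigr => i _; exact: coord_nonneg_comb.
rewrite lt0n; apply: contra b0; rewrite sum_nat_eq0 => /forallP n0.
by rewrite bn big1 // => i _; rewrite (eqP (n0 i)).
Qed.

(** Every positive root has height at least 1, so the height of xi bounds each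
multiplicity. *)
Lemma finite_partitions xi :
  finite_set [set n : {ffun pos_roots br Delta -> nat} |
    \sum_(b : pos_roots br Delta) val b *+ n b = xi].
Proof.
set S := [set _ | _]; have [[n0 n0xi]|S0] := pselect (S !=set0); last first.
  by rewrite (_ : S = set0) ?finite_set0 //; apply/eqP/negPn/negP => /set0P.
have /choice [ht htP] (b : pos_roots br Delta) : exists n, height (val b) = n%:R /\ (0 < n)%N.
  by have [|n] := height_positive_root (b := val b); [apply/in_pos_roots; exact: valP|exists n].
have hxi (n : {ffun pos_roots br Delta -> nat}) :
    \sum_(b : pos_roots br Delta) val b *+ n b = xi ->
    height xi = (\sum_b (ht b * n b))%N%:R.
  move=> <-; rewrite /height natr_sum.
  under [LHS]eq_bigr => i _.
    rewrite linear_sum.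
    under eq_bigr => b _ do rewrite linearMn.
    over.
  rewrite exchange_big; apply: eq_bigr => b _.
  rewrite sumrMnl -/(height _) (htP b).1.
  by rewrite natrM mulr_natr.
pose N := (\sum_b (ht b * n0 b))%N.
pose toN (f : {ffun pos_roots br Delta -> 'I_N.+1}) := [ffun b => val (f b)].
apply: (sub_finite_set _ (finite_image toN (finite_finpred predT))).
move=> n /= nxi; exists [ffun b => inord (n b)] => //.
apply/ffunP => b; rewrite !ffunE /= inordK // ltnS.
have -> : N = (\sum_b (ht b * n b))%N.
  by apply/eqP; rewrite -(eqr_nat R[i]) -!hxi.
rewrite (bigD1 b) //=; apply: leq_trans (leq_addr _ _).
by rewrite leq_pmull // (htP b).2.
Qed.

Lemma kostant_gt0 xi : (0 < kostant br Delta xi)%N <->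
  exists n : {ffun pos_roots br Delta -> nat},
    \sum_(b : pos_roots br Delta) val b *+ n b = xi.
Proof.
rewrite /kostant cardfs_gt0; split.
  move/fset0Pn => [n]; rewrite in_fset_set ?inE; last exact: finite_partitions.
  by exists n.
move=> [n nxi]; apply/fset0Pn; exists n.
by rewrite in_fset_set ?inE //; exact: finite_partitions.
Qed.

Lemma kostant_gt0_add xi b c : positive_root b ->
  (0 < kostant br Delta xi)%N -> (0 < kostant br Delta (xi + b *+ c))%N.
Proof.
move=> /in_pos_roots bP /kostant_gt0 [n <-]; apply/kostant_gt0.
exists [ffun x => (n x + (x == [` bP]%fset) * c)%N].
under eq_bigr do rewrite ffunE mulrnDr.
rewrite big_split /=; congr (_ + _).
rewrite (bigD1 [` bP]%fset) //= eqxx mul1n big1 ?addr0 // => x /negPf ->.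
by rewrite mul0n.
Qed.

(** * Descending along covers *)

Lemma right_refl_drop v s i : dominant_integral v -> positive_root (word s (al i)) ->
  exists c, word s v = word s (s_ i v) + word s (al i) *+ c.
Proof.
move=> Dv pos; have [n vn] := Dv i; exists n.
by rewrite simple_reflE word_reflB word_reflZ vn scaler_nat subrK.
Qed.

(** For x the product of the word s, the pairing of x v with the i-th simple
coroot has the sign of B (x v) alpha_i, which is B v (x^-1 alpha_i) by
invariance. *)
Lemma left_refl_drop v s i :
    dominant_integral v -> positive_root (word (rev s) (al i)) ->
  exists c, word s v = s_ i (word s v) + al i *+ c.
Proof.
move=> Dv pos; have [m vm] := pairing_word_int s i Dv.
have : 0 <= pairing i (word s v).
  rewrite divr_ge0 ?(ltW (form_simple_gt0 i)) // mulr_ge0 //.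
  by rewrite -(form_word_refl (rev s)) word_reflK form_positive_root_ge0.
rewrite vm ler0z; case: m vm => // n vm _; exists n.
by rewrite simple_reflE vm scaler_nat subrK.
Qed.

Variables (mu lambda : dual h).
Local Notation A := (alternation_set br Delta B lambda mu).
Hypothesis lambda_int : integral br B lambda.
Hypothesis lambda_dom : dominant br Delta B lambda.

Let nu_dominant : dominant_integral (lambda + rho br Delta).
Proof.
apply: dominant_integralD rho_dominant_integral.
exact: integral_dominant_integral lambda_int lambda_dom.
Qed.

Lemma alternation_step x y c b : weyl_group Delta B x -> positive_root b ->
  x (lambda + rho br Delta) = y (lambda + rho br Delta) + b *+ c -> A y -> A x.
Proof.
move=> Wx pb xy [_ ky]; split; first exact: Wx.
rewrite /= xy (addrAC _ (b *+ c)) (addrAC _ (b *+ c)).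
exact: kostant_gt0_add.
Qed.

Lemma alternation_right_cover x y :
  right_cover Delta B x y -> A y -> A x.
Proof.
move=> [Wx [i yE lt]]; have [s sl sx] := reduced_word Wx; subst x y.
have pos := right_ascent_positive sl lt.
have [c drop] := right_refl_drop nu_dominant pos.
exact: (alternation_step (y := word s \o s_ i) Wx pos drop).
Qed.

Lemma alternation_left_cover x y :
  left_cover Delta B x y -> A y -> A x.
Proof.
move=> [Wx [i yE lt]]; have [s sl sx] := reduced_word Wx; subst x y.
have [c drop] := left_refl_drop nu_dominant (left_ascent_positive sl lt).
exact: (alternation_step (y := s_ i \o word s) Wx (simple_positive i) drop).
Qed.
End Reflections.

Lemma order_ideal_of_covers (T : Type) (P : set T) (cov : T -> T -> Prop) (I : set T) :
    I `<=` P -> (forall x y, cov x y -> I y -> I x) ->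
  order_ideal P (clos_refl_trans _ cov) I.
Proof.
move=> IP step; split=> // x y _ _ xy.
by elim: xy => [||u v w _ uv _ vw /vw /uv] //; exact: step.
Qed.

Theorem theorem3p1 (R : realType) (g : vectType R[i]) (br : lie_bracket g)
  (g_simple : lie_simple br)
  (h : {vspace g}) (h_cartan : cartan_subalgebra br h)
  (r : nat) (r_gt0 : (1 <= r)%N) (r_rank : \dim h = r)
  (Delta : r.-tuple (dual h)) (Delta_simple : simple_roots br Delta)
  (B : dual h -> dual h -> R[i]) (B_inner : inner_product Delta B)
  (B_inv : weyl_invariant br Delta B)
  (lambda : dual h) (lambda_int : integral br B lambda)
  (lambda_dom : dominant br Delta B lambda)
  (mu : dual h) :
  order_ideal (weyl_group Delta B) (left_weak_order Delta B)
    (alternation_set br Delta B lambda mu) /\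
  order_ideal (weyl_group Delta B) (right_weak_order Delta B)
    (alternation_set br Delta B lambda mu).
Proof.
have AW : alternation_set br Delta B lambda mu `<=` weyl_group Delta B.
  by move=> w [].
split; apply: (order_ideal_of_covers AW) => x y.
- exact: alternation_left_cover.
- exact: alternation_right_cover.
Qed.
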